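(* Let $m\ge 3$ and $n\ge 2$ be integers and let $\mathscr{A}\in\mathbb{T}_{m,n}$ be a nonnegative tensor (all entries $a_{i_1\cdots i_m}\ge 0$). Then the following four properties are equivalent: (1) $\mathscr{A}$ is an $R_0$-tensor; (2) $\mathscr{A}$ is an $R$-tensor; (3) $\mathscr{A}$ is a $Q$-tensor; (4) $\mathscr{A}$ is an $ER$-tensor.
   Context: $[n]=\{1,\ldots,n\}$, $\mathbb{R}^n_+=\{x\in\mathbb{R}^n:x\ge 0\}$ (componentwise), $\mathbb{R}_+=[0,\infty)$. $\mathbb{T}_{m,n}$ is the set of real $m$-order $n$-dimensional tensors $\mathscr{A}=(a_{i_1\cdots i_m})$, $a_{i_1\cdots i_m}\in\mathbb{R}$ for $i_1,\ldots,i_m\in[n]$ (no symmetry assumed). For $x\in\mathbb{R}^n$, $\mathscr{A}x^{m-1}\in\mathbb{R}^n$ is defined by $(\mathscr{A}x^{m-1})_i=\sum_{i_2,\ldots,i_m=1}^n a_{ii_2\cdots i_m}x_{i_2}\cdots x_{i_m}$. $R$-tensor: there is no $(x,t)\in(\mathbb{R}^n_+\setminus\{0\})\times\mathbb{R}_+$ such that for all $i\in[n]$: $(\mathscr{A}x^{m-1})_i+t=0$ if $x_i>0$, and $(\mathscr{A}x^{m-1})_i+t\ge 0$ if $x_i=0$. $R_0$-tensor: there is no $x\in\mathbb{R}^n_+\setminus\{0\}$ such that for all $i\in[n]$: $(\mathscr{A}x^{m-1})_i=0$ if $x_i>0$, and $(\mathscr{A}x^{m-1})_i\ge 0$ if $x_i=0$.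 $ER$-tensor: there is no $(x,t)\in(\mathbb{R}^n_+\setminus\{0\})\times\mathbb{R}_+$ such that for all $i\in[n]$: $(\mathscr{A}x^{m-1})_i+tx_i=0$ if $x_i>0$, and $(\mathscr{A}x^{m-1})_i\ge 0$ if $x_i=0$. $Q$-tensor: for every $q\in\mathbb{R}^n$ the tensor complementarity problem TCP$(q,\mathscr{A})$ has a solution, i.e. there is $x\in\mathbb{R}^n$ with $x\ge 0$, $\mathscr{A}x^{m-1}+q\ge 0$, $x^T(\mathscr{A}x^{m-1}+q)=0$. *)

(* Defs.v *)
From HB Require Import structures.
From mathcomp Require Import all_boot all_order all_algebra.
From mathcomp Require Import reals.

Set Implicit Arguments.
Unset Strict Implicit.
Unset Printing Implicit Defensive.

Import Order.TTheory GRing.Theory Num.Theory.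
Local Open Scope ring_scope.

(* The entry a_{i_1 ... i_m} is A [tuple i_1; ...; i_m]. *)
Definition tensor (R : realType) (m n : nat) : Type := {ffun m.-tuple 'I_n -> R}.

Definition nonneg_tensor (R : realType) (m n : nat) (A : tensor R m n) : Prop :=
  forall s : m.-tuple 'I_n, 0 <= A s.

Definition nonneg_vec (R : realType) (n : nat) (x : 'cV[R]_n) : Prop :=
  forall i, 0 <= x i 0.

(* (A x^{m-1})_i: the sum over (i_2, ..., i_m) is written as the sum over the
   tuples s = (i_1, ..., i_m) whose first index i_1 is i (for m >= 1). *)
Definition tensor_app (R : realType) (m n : nat) (A : tensor R m n)
    (x : 'cV[R]_n) : 'cV[R]_n :=
  \col_i \sum_(s : m.-tuple 'I_n | ohead s == Some i)
    A s * \prod_(j <- behead s) x j 0.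

Definition R_tensor (R : realType) (m n : nat) (A : tensor R m n) : Prop :=
  ~ exists (x : 'cV[R]_n) (t : R),
      [/\ nonneg_vec x, x != 0, 0 <= t &
        forall i, (0 < x i 0 -> tensor_app A x i 0 + t = 0) /\
                  (x i 0 = 0 -> 0 <= tensor_app A x i 0 + t)].

Definition R0_tensor (R : realType) (m n : nat) (A : tensor R m n) : Prop :=
  ~ exists x : 'cV[R]_n,
      [/\ nonneg_vec x, x != 0 &
        forall i, (0 < x i 0 -> tensor_app A x i 0 = 0) /\
                  (x i 0 = 0 -> 0 <= tensor_app A x i 0)].

Definition ER_tensor (R : realType) (m n : nat) (A : tensor R m n) : Prop :=
  ~ exists (x : 'cV[R]_n) (t : R),
      [/\ nonneg_vec x, x != 0, 0 <= t &
        forall i, (0 < x i 0 -> tensor_app A x i 0 + t * x i 0 = 0) /\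
                  (x i 0 = 0 -> 0 <= tensor_app A x i 0)].

Definition TCP_solution (R : realType) (m n : nat) (q : 'cV[R]_n)
    (A : tensor R m n) (x : 'cV[R]_n) : Prop :=
  [/\ nonneg_vec x, nonneg_vec (tensor_app A x + q) &
      x^T *m (tensor_app A x + q) = 0].

Definition Q_tensor (R : realType) (m n : nat) (A : tensor R m n) : Prop :=
  forall q : 'cV[R]_n, exists x : 'cV[R]_n, TCP_solution q A x.

(* Main.v *)
Require Import Defs.
From HB Require Import structures.
From mathcomp Require Import all_boot all_order all_algebra.
From mathcomp Require Import reals interval_inference boolp classical_sets.
From mathcomp Require Import topology normedtype zify lra.
(* Names shared with classical_sets denote the finite-set versions. *)
From mathcomp Require Import fintype finset.

Set Implicit Arguments.
Unset Strict Implicit.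
Unset Printing Implicit Defensive.

Import Order.TTheory GRing.Theory Num.Theory numFieldNormedType.Exports.

(** For a nonnegative tensor each of the four properties amounts to positivity
    of the diagonal entries a_{i...i}.  The only deep implication is that a
    positive diagonal gives the Q-property, which needs a fixed-point argument.
    It rests on Scarf's lemma.  Let a finite set carry a linear order for each
    index i, and contain for each i a slack element which is lowest in the order
    i and above all genuine elements in the other orders.  Call a subset dominant
    if every element is, in the order of some index, below the whole subset.
    Then for every coloring of the elements by the indices that gives the i-th
    slack the color i, some dominant set carries all the colors.  Applied to the
    grid points of a simplex, ordered by their coordinates, this shows that if
    closed sets F_i cover the simplex, then some point p of it lies in F_i
    whenever p_i > 0.  Taking for F_i the points where the i-th residual is
    minimal, with an additional coordinate of residual 0, solves every coercive
    nonlinear complementarity problem. *)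

(** * Scarf's lemma *)

Section Redundant.
Variables (aT rT : finType) (f : aT -> rT).
Implicit Types A : {set aT}.

Definition redundant A : {set aT} := [set x in A | f @: (A :\ x) == f @: A].

Lemma redundant_collision A x y :
  x \in A -> y \in A -> x != y -> f x = f y -> x \in redundant A.
Proof.
move=> xA yA xy fxy; rewrite inE xA -{2}(setD1K xA) imsetU1.
by apply/eqP/esym/setUidPr; rewrite sub1set fxy imset_f // !inE eq_sym xy.
Qed.

Lemma card_redundant A : #|A| = #|f @: A|.+1 -> #|redundant A| = 2.
Proof.
move=> cardA.
have [x xA [y /andP[/= yx yA] fxy]] :
    exists2 x, x \in A & exists2 y, y \in [predD1 A & x] & f x = f y.
  by apply/dinjectivePn/dinjectiveP => /card_in_imset; rewrite cardA => /n_Sn.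
have xy : x != y by rewrite eq_sym.
suff -> : redundant A = [set x; y] by rewrite cards2 xy.
apply/setP => w; apply/idP/set2P; last first.
  case=> ->; first exact: redundant_collision xA yA _ _.
  exact: redundant_collision yA xA _ (esym fxy).
rewrite inE => /andP[wA /eqP fw]; apply/set2P.
rewrite !inE; apply: contraT; rewrite negb_or => /andP[wx wy].
have /imset_injP/(_ x y) : #|f @: (A :\ w)| == #|A :\ w|.
  by move: cardA; rewrite (cardsD1 w A) wA fw add1n => -[->].
rewrite !inE !(eq_sym _ w) wx wy => /(_ xA yA fxy) /eqP.
by rewrite (negPf xy).
Qed.

Lemma dvdn2_card_near_onto A u : #|rT| = #|A| -> f @: A != setT ->
  2 %| #|[set x in A | f @: (A :\ x) == [set~ u]]|.
Proof.
move=> cardA not_onto.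
have [->|[x]] := set_0Vmem [set x in A | f @: (A :\ x) == [set~ u]].
  by rewrite cards0.
rewrite inE => /andP[xA /eqP fx].
have fA : f @: A = [set~ u].
  have fA : f @: A = f x |: [set~ u] by rewrite -fx -imsetU1 setD1K.
  have [fxu|fxu] := eqVneq (f x) u.
    by rewrite fA fxu setUCr eqxx in not_onto.
  by rewrite fA; apply/setUidPr; rewrite sub1set !inE.
rewrite -fA [X in dvdn _ X]card_redundant //.
by rewrite fA cardsC1 -cardA prednK //; apply/card_gt0P; exists u.
Qed.

End Redundant.

Section Dominance.
Variables (Y I : finType) (rk : I -> Y -> nat).
Hypothesis rk_inj : forall i, injective (rk i).
Implicit Types (s t : {set Y}) (i j k : I) (x y w : Y).

Definition dominant s : bool :=
  [forall y, exists i, forall x in s, rk i y <= rk i x].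

Lemma dominantP s :
  reflect (forall y, exists i, {in s, forall x, rk i y <= rk i x}) (dominant s).
Proof.
apply: (iffP forallP) => domS y.
  by have /existsP[i /forall_inP] := domS y; exists i.
by have [i iy] := domS y; apply/existsP; exists i; apply/forall_inP.
Qed.

Lemma dominantS s t : t \subset s -> dominant s -> dominant t.
Proof.
move=> /subsetP ts /dominantP domS; apply/dominantP => y.
by have [i iy] := domS y; exists i => x /ts; apply: iy.
Qed.

Lemma rk_anti i x y : rk i x <= rk i y -> rk i y <= rk i x -> x = y.
Proof. by move=> xy yx; apply: (@rk_inj i); apply/eqP; rewrite eqn_leq xy. Qed.

Section Lowest.
Variables (x0 : Y) (s : {set Y}).
Hypothesis x0s : x0 \in s.

Definition lowest i : Y := [arg min_(x < x0 in s) rk i x].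

Lemma lowest_in i : lowest i \in s.
Proof. by rewrite /lowest; case: arg_minnP. Qed.

Lemma lowest_le i : {in s, forall x, rk i (lowest i) <= rk i x}.
Proof. by rewrite /lowest; case: arg_minnP. Qed.

Lemma eq_lowest i x :
  x \in s -> {in s, forall y, rk i x <= rk i y} -> lowest i = x.
Proof.
by move=> xs xmin; apply: rk_anti (lowest_le _ xs) (xmin _ (lowest_in i)).
Qed.

Lemma dominant_lowest_onto : dominant s -> lowest @: setT = s.
Proof.
move=> /dominantP domS; apply/setP => x; apply/imsetP/idP => [[i _ ->]|xs].
  exact: lowest_in.
by have [i xi] := domS x; exists i; rewrite ?(eq_lowest xs xi).
Qed.

Lemma dominant_lowest_inj : dominant s -> #|I| = #|s| -> injective lowest.
Proof.
move=> domS cardS i j; apply: (imset_injP _) => //.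
by rewrite dominant_lowest_onto // cardsT cardS.
Qed.

End Lowest.

Definition pivots t : {set Y} := [set x | (x \notin t) && dominant (x |: t)].

Section Pivots.
Variables (t : {set Y}) (x0 : Y).
Hypotheses (x0t : x0 \in t) (domT : dominant t) (cardI : #|I| = #|t|.+1).

Definition beyond i : {set Y} :=
  [set y | [forall j, (j != i) ==> (rk j (lowest x0 t j) < rk j y)]].

Definition highest_beyond i : Y := [arg max_(y > x0 in beyond i) rk i y].

Lemma beyondP i y :
  reflect (forall j, j != i -> rk j (lowest x0 t j) < rk j y) (y \in beyond i).
Proof. by rewrite inE; apply: forall_inP. Qed.

Lemma beyond_le i y : y \in beyond i -> {in t, forall x, rk i y <= rk i x}.
Proof.
move=> /beyondP yi; have /dominantP/(_ y)[j jy] := domT.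
have [<- //|/yi] := eqVneq j i.
by rewrite ltnNge jy ?lowest_in.
Qed.

Lemma highest_beyondP i : beyond i != set0 ->
  highest_beyond i \in beyond i /\
  {in beyond i, forall y, rk i y <= rk i (highest_beyond i)}.
Proof.
case/set0Pn => y yi; rewrite /highest_beyond /arg_max /extremum.
case: pickP => [x /andP[xi /forall_inP xmax] //|nomax].
case: (arg_maxnP (rk i) yi) => x xi xmax.
by case/andP: (nomax x); split=> //; apply/forall_inP.
Qed.

Lemma redundant_highest_pivot i :
  i \in redundant (lowest x0 t) setT -> beyond i != set0 ->
  highest_beyond i \in pivots t.
Proof.
rewrite !inE (dominant_lowest_onto x0t domT) => /eqP onto /highest_beyondP.
set x := highest_beyond i => -[xi xmax]; apply/andP; split.
  apply/negP; rewrite -onto => /imsetP[j]; rewrite !inE andbT => ji xj.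
  by have /beyondP/(_ j ji) := xi; rewrite {1}xj ltnn.
apply/dominantP => y; have [yi|] := boolP (y \in beyond i).
  exists i => w /setU1P[->|]; [exact: xmax | exact: beyond_le].
rewrite inE negb_forall => /existsP[j].
rewrite negb_imply -leqNgt => /andP[ji yj].
exists j => w /setU1P[->|wt]; last exact: leq_trans yj (lowest_le x0t _ wt).
by apply: leq_trans yj (ltnW _); apply/beyondP: ji.
Qed.

(* The minima over x |: t are pairwise distinct, so x is the minimum for a single
   index i; dropping i, the other minima already lie in t. *)
Lemma pivot_redundant x : x \in pivots t ->
  exists i, [/\ i \in redundant (lowest x0 t) setT,
    beyond i != set0 & highest_beyond i = x].
Proof.
rewrite inE => /andP[xt domX]; pose low := lowest x0 (x |: t).
have x0x : x0 \in x |: t by rewrite inE x0t orbT.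
have low_inj : injective low.
  by apply: dominant_lowest_inj => //; rewrite cardI cardsU1 xt.
have onto : low @: setT = x |: t by apply: dominant_lowest_onto.
have [i _ xi] : exists2 i, i \in setT & x = low i.
  by apply/imsetP; rewrite onto setU11.
have low_in j : j != i -> low j \in t.
  move=> ji; have /setU1P[|//] := lowest_in x0x j.
  by rewrite [RHS]xi => /low_inj /eqP; rewrite (negPf ji).
have lowE j : j != i -> lowest x0 t j = low j.
  move=> ji; apply: (eq_lowest x0t (low_in j ji)) => y yt.
  by apply: (lowest_le x0x); rewrite inE yt orbT.
have x_beyond : x \in beyond i.
  apply/beyondP => j ji.
  rewrite lowE // ltn_neqAle (lowest_le x0x) ?setU11 // andbT.
  by apply: contraNneq xt => /rk_inj <-; apply: low_in.
have beyond_i : beyond i != set0 by apply/set0Pn; exists x.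
exists i; split=> //.
- rewrite inE (dominant_lowest_onto x0t domT) inE; apply/eqP/setP => w.
  apply/imsetP/idP => [[j _ ->]|wt]; first exact: lowest_in.
  have /imsetP[j _ wj] : w \in low @: setT by rewrite onto inE wt orbT.
  have ji : j != i by apply: contraNneq xt => ji; rewrite xi -ji -wj.
  by exists j; rewrite ?inE ?ji ?lowE.
- have [hi hmax] := highest_beyondP beyond_i.
  apply: (@rk_anti i); last exact: hmax.
  have /dominantP/(_ (highest_beyond i))[j jh] := domX.
  have [ji|ji] := eqVneq j i; first by subst j; apply/jh/setU11.
  have /beyondP/(_ j ji) := hi.
  by rewrite ltnNge jh // inE lowest_in ?orbT.
Qed.

Lemma card_pivots :
  #|pivots t| = #|[set i in redundant (lowest x0 t) setT | beyond i != set0]|.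
Proof.
have highest_inj :
    {in [set i in redundant (lowest x0 t) setT | beyond i != set0] &,
      injective highest_beyond}.
  move=> i j /setIdP[_ /highest_beyondP[hi _]] /setIdP[_ /highest_beyondP[hj _]].
  move=> hij; apply/eqP; apply: contraT => ij; have /beyondP/(_ j) := hi.
  by rewrite eq_sym ij hij ltnNge beyond_le ?lowest_in // => /(_ isT).
rewrite -(card_in_imset highest_inj); congr #|pred_of_set _|.
apply/setP => x; apply/idP/imsetP => [/pivot_redundant|].
  by case=> i [ri bi <-]; exists i; rewrite // inE ri.
by case=> i /setIdP[ri bi] ->; apply: redundant_highest_pivot.
Qed.

End Pivots.

Section Slack.
Variables (slack : I -> Y) (color : Y -> I).

Definition genuine : {set Y} := [set y | y \notin codom slack].

Hypothesis slack_lowest : forall i y, rk i (slack i) <= rk i y.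
Hypothesis slack_high :
  forall i j y, j != i -> y \in genuine -> rk i y < rk i (slack j).
Hypothesis color_slack : cancel slack color.

Lemma card_pivots_genuine t x : dominant t -> #|I| = #|t|.+1 ->
  x \in t -> x \in genuine -> #|pivots t| = 2.
Proof.
move=> domT cardI xt x_genuine; rewrite (card_pivots xt) //.
have onto := dominant_lowest_onto xt domT.
rewrite -(card_redundant (f := lowest x t) (A := setT)) ?onto ?cardsT //.
congr #|pred_of_set _|; apply/setP => i; rewrite inE andbC.
suff -> : beyond t x i != set0 by [].
apply/set0Pn; exists (slack i); apply/beyondP => j ji.
apply: leq_ltn_trans (lowest_le xt _ xt) (slack_high _ x_genuine).
by rewrite eq_sym.
Qed.

Lemma genuine_below_slackF i y :
  y \in genuine -> rk i y <= rk i (slack i) = false.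
Proof.
move=> y_genuine; apply/negP => /rk_anti/(_ (slack_lowest i y)) y_slack.
by move: y_genuine; rewrite inE y_slack codom_f.
Qed.

Definition slack_facet i : {set Y} := slack @: [set~ i].

Lemma slack_facet_pivot_genuine i x y : y \in genuine ->
  x \in pivots (slack_facet i) -> x \in genuine.
Proof.
move=> y_genuine; rewrite !inE => /andP[xt domX].
apply/negP => /codomP[j xj]; subst x.
have [k ky] := dominantP _ domX y.
have : slack k \in slack j |: slack_facet i.
  have [->|kj] := eqVneq k j; first exact: setU11.
  rewrite inE imset_f ?orbT // !inE; apply: contraNneq xt => ki.
  by rewrite imset_f // !inE -ki eq_sym.
by move/ky; rewrite genuine_below_slackF.
Qed.

Lemma slack_facet_pivotP i x : x \in genuine ->
  reflect (forall y, y \in genuine -> rk i y <= rk i x)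
          (x \in pivots (slack_facet i)).
Proof.
move=> x_genuine.
have xt : x \notin slack_facet i.
  by apply: contraL x_genuine => /imsetP[j _ ->]; rewrite inE negbK codom_f.
rewrite inE xt; apply: (iffP (dominantP _)) => [domX y y_genuine|xmax y].
  have [j jy] := domX y; have [<-|ji] := eqVneq j i; first by rewrite jy ?setU11.
  have : slack j \in x |: slack_facet i by rewrite inE imset_f ?orbT // !inE.
  by move/jy; rewrite genuine_below_slackF.
have [y_genuine|] := boolP (y \in genuine); last first.
  by rewrite inE negbK => /codomP[j ->]; exists j => w _; apply: slack_lowest.
exists i => w /setU1P[->|/imsetP[j + ->]]; first exact: xmax.
by rewrite !inE => ji; apply/ltnW/slack_high.
Qed.

Lemma card_pivots_slack_facet i y :
  y \in genuine -> #|pivots (slack_facet i)| = 1.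
Proof.
move=> y_genuine; case: (arg_maxnP (rk i) y_genuine) => x x_genuine xmax.
apply/eqP/cards1P; exists x; apply/setP => w; rewrite inE.
apply/idP/eqP => [wt|->]; last exact/slack_facet_pivotP.
have w_genuine := slack_facet_pivot_genuine y_genuine wt.
apply: (@rk_anti i); first exact: xmax.
exact: (slack_facet_pivotP _ w_genuine wt).
Qed.

(* The doors of the parity argument: each lies in two dominant sets of size #|I|,
   except for the slack facet, which lies in only one. *)
Definition near_rainbow i t : bool :=
  [&& dominant t, #|I| == #|t|.+1 & color @: t == [set~ i]].

Lemma slack_facet_near_rainbow i y :
  y \in genuine -> near_rainbow i (slack_facet i).
Proof.
move=> y_genuine; have := card_pivots_slack_facet i y_genuine.
case/eqP/cards1P=> x /setP/(_ x); rewrite !inE eqxx => /andP[_ domX].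
apply/and3P; split; first exact: dominantS (subsetUr _ _) domX.
  rewrite (card_imset _ (can_inj color_slack)) cardsC1 prednK //.
  by apply/card_gt0P; exists i.
by rewrite -imset_comp (eq_imset (g := id)) ?imset_id.
Qed.

Lemma near_rainbow_slackE i t :
  near_rainbow i t -> t \subset codom slack -> t = slack_facet i.
Proof.
case/and3P=> _ _ /eqP color_t /subsetP t_slack.
rewrite /slack_facet -color_t -imset_comp -[LHS]imset_id.
apply: eq_in_imset => x /t_slack /codomP[j ->] /=.
by rewrite color_slack.
Qed.

Lemma sum_pivots_near_rainbow i :
  \sum_(t | near_rainbow i t) #|pivots t| =
  \sum_(s | dominant s && (#|I| == #|s|))
    #|[set x in s | color @: (s :\ x) == [set~ i]]|.
Proof.
under eq_bigr do rewrite -sum1dep_card big_mkcond /=.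
under [RHS]eq_bigr do rewrite -sum1dep_card big_mkcond /=.
rewrite exchange_big [RHS]exchange_big /=; apply: eq_bigr => x _.
rewrite -!big_mkcondr /=.
rewrite (reindex_onto (fun s => s :\ x) (fun t => x |: t)) /=; last first.
  by move=> t /and3P[_ xt _]; rewrite setU1K.
apply: eq_bigl => s; rewrite setD11 /near_rainbow.
have [xs|xs] := boolP (x \in s); last first.
  by rewrite !andbF; apply/negP => /andP[_ /eqP sx]; rewrite -sx setU11 in xs.
rewrite setD1K // eqxx (cardsD1 x s) xs add1n.
have [domS|] := boolP (dominant s); last by rewrite !andbF.
by rewrite (dominantS (subD1set s x) domS) !andbT.
Qed.

Lemma odd_sum_pivots i y :
  y \in genuine -> odd (\sum_(t | near_rainbow i t) #|pivots t|).
Proof.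
move=> y_genuine.
rewrite (bigD1 _ (slack_facet_near_rainbow i y_genuine)) oddD.
rewrite (card_pivots_slack_facet i y_genuine) /= -dvdn2.
apply: dvdn_sum => t /andP[nt t_facet].
have /subsetPn[x xt x_genuine] : ~~ (t \subset codom slack).
  by apply: contra t_facet => /(near_rainbow_slackE nt) ->.
case/and3P: nt => domT /eqP cardI _.
by rewrite (card_pivots_genuine domT cardI xt) // inE.
Qed.

Theorem scarf_lemma y :
  y \in genuine -> exists2 s, dominant s & color @: s = setT.
Proof.
move=> y_genuine.
have [s /andP[domS /eqP color_s]|no_rainbow] :=
  pickP (fun s => dominant s && (color @: s == setT)); first by exists s.
have := odd_sum_pivots (color y) y_genuine.
rewrite -[odd _]negbK -dvdn2 => /negP[]; rewrite sum_pivots_near_rainbow.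
apply: dvdn_sum => s /andP[domS /eqP cardI].
by rewrite dvdn2_card_near_onto //; have := no_rainbow s; rewrite domS /= => ->.
Qed.

End Slack.
End Dominance.

(** * Complementarity on the simplex *)

Section TieRank.
Variables (T : finType) (f : T -> nat).
Implicit Types x y : T.

Definition tie_rank x : nat := f x * #|T| + enum_rank x.

Lemma tie_rank_lt x y : f x < f y -> tie_rank x < tie_rank y.
Proof.
move=> xy; apply: (@leq_trans ((f x).+1 * #|T|)).
  by rewrite /tie_rank mulSn addnC ltn_add2r.
exact: leq_trans (leq_mul xy (leqnn _)) (leq_addr _ _).
Qed.

Lemma tie_rank_le x y : tie_rank x <= tie_rank y -> f x <= f y.
Proof. by apply: contraTT; rewrite -!ltnNge; apply: tie_rank_lt. Qed.

Lemma tie_rank_inj : injective tie_rank.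
Proof.
move=> x y xy; have fxy : f x = f y.
  by apply/eqP; rewrite eqn_leq !tie_rank_le ?xy.
by move: xy; rewrite /tie_rank fxy => /addnI/val_inj/enum_rank_inj.
Qed.

End TieRank.

Section Grid.
Variables k N : nat.

Definition grid_point : Type :=
  {g : {ffun 'I_k.+1 -> 'I_N.+1} | \sum_j (g j : nat) == N}.

Definition coord (g : grid_point) (i : 'I_k.+1) : nat := val g i.

Implicit Types (g : grid_point) (s : {set grid_point}).
Implicit Types (i j : 'I_k.+1) (C : {set 'I_k.+1}).

Lemma sum_coord g : \sum_j coord g j = N.
Proof. exact: eqP (valP g). Qed.

Lemma exists_grid_point (f : 'I_k.+1 -> nat) : \sum_j f j = N ->
  exists g, forall j, coord g j = f j.
Proof.
move=> fN.
have fle j : f j < N.+1 by rewrite ltnS -fN (bigD1 j) //= leq_addr.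
have gN : \sum_j ([ffun j => Ordinal (fle j)] j : nat) == N.
  by rewrite -[X in _ == X]fN; apply/eqP/eq_bigr => j _; rewrite ffunE.
by exists (exist _ [ffun j => Ordinal (fle j)] gN) => j; rewrite /coord ffunE.
Qed.

Lemma card_grid_point_gt0 : 0 < #|{: grid_point}|.
Proof.
have [g _] : exists g, forall j, coord g j = (j == ord0) * N.
  apply: exists_grid_point; rewrite (bigD1 ord0) //= mul1n big1 ?addn0 // => j.
  by move/negPf->.
by apply/card_gt0P; exists g.
Qed.

(* The slack vertex inr i lies below the whole grid in coordinate i and above it
   in the others. *)
Definition extended_coord i (y : grid_point + 'I_k.+1) : nat :=
  match y with
  | inl g => (coord g i).+1
  | inr j => if j == i then 0 else N.+2
  end.

Definition dominant_cell s C : Prop :=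
  forall g, exists2 i, i \in C & {in s, forall g', coord g i <= coord g' i}.

Lemma extended_coord_slack i y :
  y != inr i -> extended_coord i (inr i) < extended_coord i y.
Proof.
by case: y => [g|j] /=; rewrite eqxx //; have [->|] := eqVneq j i; rewrite ?eqxx.
Qed.

Lemma rainbow_dominant_cell (c : grid_point -> 'I_k.+1) :
  exists s C, dominant_cell s C /\ C \subset c @: s.
Proof.
pose rk i := tie_rank (extended_coord i).
pose slack : 'I_k.+1 -> grid_point + 'I_k.+1 := inr.
pose color (y : grid_point + 'I_k.+1) :=
  match y with inl g => c g | inr i => i end.
have genuineE y : (y \in genuine slack) = if y is inl _ then true else false.
  by rewrite inE; case: y => [g|i]; [apply/negP => /codomP[] | rewrite codom_f].
have slack_lowest i y : rk i (slack i) <= rk i y.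
  have [->//|yi] := eqVneq y (inr i); exact/ltnW/tie_rank_lt/extended_coord_slack.
have slack_high i j y : j != i -> y \in genuine slack -> rk i y < rk i (slack j).
  rewrite genuineE; case: y => // g /negPf ji _.
  by apply: tie_rank_lt; rewrite /= ji ltnS; apply: ltn_ord.
have /card_gt0P[g0 _] := card_grid_point_gt0.
have color_slack : cancel slack color by [].
have g0_genuine : inl g0 \in genuine slack by rewrite genuineE.
have rk_inj i : injective (rk i) := @tie_rank_inj _ _.
have [t /dominantP dom_t color_t] :=
  scarf_lemma rk_inj slack_lowest slack_high color_slack g0_genuine.
exists [set g | inl g \in t], [set i | inr i \notin t]; split.
  move=> g; have [i ig] := dom_t (inl g); exists i.
    by rewrite inE; apply/negP => /ig /tie_rank_le; rewrite /= eqxx.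
  by move=> g'; rewrite inE => /ig /tie_rank_le.
apply/subsetP => i; rewrite inE => it.
have : i \in color @: t by rewrite color_t.
case/imsetP => -[g|j] yt /= ij; first by rewrite ij imset_f // inE.
by rewrite ij yt in it.
Qed.

(* Otherwise some grid point would exceed the floor in every coordinate of C. *)
Lemma dominant_floor_sum_gt C (floor : 'I_k.+1 -> nat) :
  (forall g, exists2 i, i \in C & coord g i <= floor i) ->
  N < \sum_(i in C) (floor i).+1.
Proof.
move=> dom; rewrite ltnNge; apply/negP => le_N.
have /card_gt0P[g0 _] := card_grid_point_gt0.
have [i1 i1C _] := dom g0.
have [g gE] : exists g, forall j, coord g j =
    if j \in C then
      (floor j).+1 + (j == i1) * (N - \sum_(i in C) (floor i).+1)
    else 0.
  apply: exists_grid_point.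
  rewrite -big_mkcond big_split /= [X in _ + X](bigD1 i1) //=.
  rewrite eqxx mul1n [X in _ + (_ + X)]big1 ?addn0 ?subnKC // => j.
  by case/andP=> _ /negPf->.
have [i iC] := dom g.
by rewrite leqNgt gE iC addSn ltnS leq_addr.
Qed.

Lemma coord_le_floor C (floor : 'I_k.+1 -> nat) g :
  N < \sum_(i in C) (floor i).+1 -> (forall i, floor i <= coord g i) ->
  forall j, coord g j <= (if j \in C then floor j else 0) + k.
Proof.
move=> N_lt floor_g j.
have {}N_lt : N < \sum_(i in C) floor i + #|C|.
  by move: N_lt; under eq_bigr do rewrite -addn1; rewrite big_split /= sum1_card.
have cardC : #|C| <= k.+1 by rewrite -[leqRHS]card_ord max_card.
have others : coord g j + \sum_(i in C | i != j) floor i <= N.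
  rewrite -[leqRHS](sum_coord g) [leqRHS](bigD1 j) //= leq_add2l big_mkcondl /=.
  by apply: leq_sum => i _; case: ifP.
have split_j :
    \sum_(i in C) floor i =
    (if j \in C then floor j else 0) + \sum_(i in C | i != j) floor i.
  case: ifP => jC; first exact: bigD1.
  rewrite add0n; apply: eq_bigl => i.
  by case: eqVneq => [->|]; rewrite ?jC ?andbT.
move: N_lt others; rewrite split_j.
by move: (bigop _ _ _) (if _ then _ else _); lia.
Qed.

Lemma small_rainbow_cell (c : grid_point -> 'I_k.+1) :
  exists g, forall i, k < coord g i ->
    exists2 g', c g' = i &
      forall j, coord g' j <= coord g j + k /\ coord g j <= coord g' j + k.
Proof.
have [s [C [dom /subsetP Cc]]] := rainbow_dominant_cell c.
have [g gs] : exists g, g \in s.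
  have /card_gt0P[g0 _] := card_grid_point_gt0.
  by have [i /Cc/imsetP[g gs _] _] := dom g0; exists g.
pose floor i := coord [arg min_(h < g in s) coord h i] i.
have floor_le h i : h \in s -> floor i <= coord h i.
  by rewrite /floor; case: arg_minnP => // h' _; apply.
have N_lt : N < \sum_(i in C) (floor i).+1.
  apply: dominant_floor_sum_gt => h; have [i iC hi] := dom h; exists i => //.
  by apply: hi; rewrite /floor; case: arg_minnP.
have near h h' j : h \in s -> h' \in s -> coord h j <= coord h' j + k.
  move=> hs h's; apply: leq_trans (coord_le_floor N_lt (floor_le h ^~ hs) j) _.
  by rewrite leq_add2r; case: ifP => // _; apply: floor_le.
exists g => i gi; have : i \in C.
  apply: contraTT gi => /negPf iC; rewrite -leqNgt.
  by have := coord_le_floor N_lt (floor_le g ^~ gs) i; rewrite iC.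
by move/Cc/imsetP => [g' g's ->]; exists g' => // j; split; apply: near.
Qed.

End Grid.

Local Open Scope classical_set_scope.
Local Open Scope ring_scope.

Lemma continuous_mx (R : numDomainType) (U : pseudoMetricType R)
    (T : topologicalType) (m n : nat) (f : T -> 'M[U]_(m, n)) :
  (forall i j, continuous (fun x => f x i j)) -> continuous f.
Proof.
move=> fc x; apply/cvg_ballP => e e0.
have coords i j : \forall y \near x, ball (f x i j) e (f y i j).
  by have /cvg_ballP := fc i j x; apply.
apply: filterS (filter_forall _ (fun ij => coords ij.1 ij.2)) => y fy.
by split=> // i j; apply: (fy (i, j)).
Qed.

Section Simplex.
Variables (R : realType) (k : nat).
Implicit Types (p : 'rV[R]_k.+1) (i j l : 'I_k.+1).

Definition simplex : set 'rV[R]_k.+1 :=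
  [set p | (forall i, 0 <= p 0 i) /\ \sum_i p 0 i = 1].

Lemma simplex_compact : compact simplex.
Proof.
have cube_compact :=
  @rV_compact R k.+1 (fun=> `[0, 1]%classic) (fun=> @segment_compact R 0 1).
apply: subclosed_compact cube_compact _.
- have -> : simplex =
      \bigcap_i [set p : 'rV_k.+1 | 0 <= p 0 i] `&` [set p | \sum_i p 0 i = 1].
    by apply/seteqP; split=> p [p0 p1]; split=> // i; [move=> _|]; apply: p0.
  apply: closedI.
    apply: closed_bigI => i _.
    by apply: (continuous_closedP _).1 (@closed_ge R 0); apply: coord_continuous.
  apply: (continuous_closedP (fun p => \sum_i p 0 i)).1 (@closed_eq R 1).
  apply: continuous_big => [|i _]; first exact: add_continuous.
  exact: coord_continuous.
- move=> p [p0 p1] i /=; rewrite in_itv /= p0 -p1 (bigD1 i) //= lerDl.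
  by rewrite sumr_ge0.
Qed.

Lemma closed_cover_approx (F : 'I_k.+1 -> set 'rV[R]_k.+1) (e : R) :
  simplex `<=` \bigcup_i F i -> 0 < e ->
  exists2 p, simplex p & forall i, e < p 0 i -> exists2 z, F i z & ball p e z.
Proof.
move=> cover e0.
pose N := Num.bound (k%:R / e).
have kN : k%:R < e * N%:R.
  by rewrite mulrC -ltr_pdivrMr // archi_boundP // divr_ge0 // ltW.
have N_gt0 : 0 < N%:R :> R by rewrite -(pmulr_rgt0 _ e0); apply: le_lt_trans kN.
pose pt g : 'rV[R]_k.+1 := \row_j ((@coord k N g j)%:R / N%:R).
have pt_simplex g : simplex (pt g).
  split=> [i|]; first by rewrite mxE divr_ge0.
  under eq_bigr do rewrite mxE.
  by rewrite -mulr_suml -natr_sum sum_coord divff // gt_eqF.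
have /choice[c cP] : forall g, exists i, F i (pt g).
  by move=> g; have [i _] := cover _ (pt_simplex g); exists i.
have [g gP] := small_rainbow_cell c; exists (pt g) => // i.
rewrite mxE ltr_pdivlMr // => egi; have [|g' <- near] := gP i.
  by rewrite -(ltr_nat R) (lt_trans kN).
exists (pt g') => //; split=> // a j; rewrite (ord1 a) /ball /= !mxE -mulrBl.
rewrite normrM [`|_^-1|]gtr0_norm ?invr_gt0 // ltr_pdivrMr //.
rewrite (le_lt_trans _ kN) // ler_norml.
by have [] := near j; rewrite -!(ler_nat R) !natrD; lra.
Qed.

Theorem closed_cover_simplex (F : 'I_k.+1 -> set 'rV[R]_k.+1) :
  (forall i, closed (F i)) -> simplex `<=` \bigcup_i F i ->
  exists2 p, simplex p & forall i, 0 < p 0 i -> F i p.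
Proof.
move=> F_closed cover.
have /choice[u uP] : forall n, exists p, simplex p /\
    forall i, n.+1%:R^-1 < p 0 i -> exists2 z, F i z & ball p n.+1%:R^-1 z.
  move=> n; have inv_gt0 : 0 < n.+1%:R^-1 :> R by rewrite invr_gt0.
  by have [p ps pP] := closed_cover_approx cover inv_gt0; exists p.
have [p ps p_cluster] : exists2 p, simplex p & cluster (u @ \oo) p.
  have [|p [ps p_cluster]] := @simplex_compact (u @ \oo) _; last by exists p.
  by exists 0%N => // n _; have [] := uP n.
exists p => // i pi; apply: F_closed => B /nbhs_ballP[e /= e0 eB].
have [d d0 [de dp]] : exists2 d : R, 0 < d & d + d <= e /\ d + d <= p 0 i.
  exists (Num.min e (p 0 i) / 2); first by rewrite divr_gt0 ?lt_min ?e0.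
  by rewrite -splitr !ge_min !lexx orbT.
have small := near_infty_natSinv_lt (PosNum d0).
have [] := p_cluster (u @` [set n | n.+1%:R^-1 < d]) (ball p d).
- by apply: filterS small => n nd; exists n.
- exact: nbhsx_ballx.
move=> _ [[n /= nd <-] un]; have [_ /(_ i)[|z Fz uz]] := uP n.
  have [_ /(_ 0 i)] := un; rewrite /ball /= ltr_distlC => /andP[uni _].
  by apply: lt_trans nd _; lra.
exists z; split=> //; apply: eB; apply: le_ball de _ _.
by apply: ball_triangle un _; apply: le_ball (ltW nd) _ uz.
Qed.

Corollary complementary_simplex (h : 'I_k.+1 -> 'rV[R]_k.+1 -> R) :
  (forall i, continuous (h i)) ->
  exists2 p, simplex p & forall i, 0 < p 0 i -> forall l, h i p <= h l p.
Proof.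
move=> hc; pose F i := [set p | forall l, h i p <= h l p].
have F_closed i : closed (F i).
  have -> : F i = \bigcap_l [set p | 0 <= h l p - h i p].
    apply/seteqP; split=> p hp l => [_|]; first by rewrite /= subr_ge0.
    by have := hp l I; rewrite /= subr_ge0.
  apply: closed_bigI => l _; apply: (continuous_closedP _).1 (@closed_ge R 0).
  by move=> p; apply: cvgB (hc l p) (hc i p).
apply: (closed_cover_simplex F_closed) => p _.
exists [arg min_(i < ord0) h i p]%O => //= l.
by case: Order.TotalTheory.arg_minP => // i _; apply.
Qed.

End Simplex.

Section NonlinearComplementarity.
Variables (R : realType) (n : nat) (f : 'I_n -> 'cV[R]_n -> R) (rho : R).
Hypothesis f_continuous : forall i, continuous (f i).
Hypothesis rho_gt0 : 0 < rho.
Hypothesis f_coercive : forall i (x : 'cV[R]_n),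
  nonneg_vec x -> rho <= x i 0 -> 0 < f i x.

Definition simplex_to_orthant (p : 'rV[R]_n.+1) : 'cV[R]_n :=
  \col_i (n.+1%:R * rho * p 0 (lift ord0 i)).

Lemma simplex_to_orthant_continuous : continuous simplex_to_orthant.
Proof.
apply: continuous_mx => i j.
have -> : (fun p => simplex_to_orthant p i j) =
          (fun p : 'rV_n.+1 => n.+1%:R * rho * p 0 (lift ord0 i)).
  by apply: funext => p; rewrite mxE.
by move=> p; apply: cvgM (cvg_cst _) (@coord_continuous _ _ _ _ _ p).
Qed.

Lemma simplex_to_orthant_ge0 p : simplex p -> nonneg_vec (simplex_to_orthant p).
Proof. by case=> p0 _ i; rewrite mxE !mulr_ge0 // ltW. Qed.

Lemma simplex_slack_gt0 p : simplex p ->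
  (forall i, simplex_to_orthant p i 0 <= rho) -> 0 < p 0 ord0.
Proof.
move=> [_ p1] p_le; pose scale := n.+1%:R * rho.
have scale_gt0 : 0 < scale by rewrite mulr_gt0.
have scaleE : scale = n%:R * rho + rho by rewrite /scale -natr1 mulrDl mul1r.
have scaled_sum : scale * (1 - p 0 ord0) = \sum_i simplex_to_orthant p i 0.
  rewrite -[X in X - _]p1 big_ord_recl addrAC subrr add0r mulr_sumr.
  by apply: eq_bigr => i _; rewrite mxE.
have sum_le : \sum_i simplex_to_orthant p i 0 <= n%:R * rho.
  apply: le_trans (ler_sum _ (fun i _ => p_le i)) _.
  by rewrite sumr_const card_ord mulr_natl.
rewrite -(pmulr_rgt0 _ scale_gt0).
by move: sum_le rho_gt0; rewrite -scaled_sum; lra.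
Qed.

(* The slack coordinate ord0 has residual 0, so minimality of the residuals at
   positive coordinates is complementarity once the slack is positive. *)
Theorem complementarity_solution : exists x : 'cV[R]_n,
  [/\ nonneg_vec x, forall i, 0 <= f i x & forall i, x i 0 * f i x = 0].
Proof.
pose h (j : 'I_n.+1) (p : 'rV[R]_n.+1) : R :=
  if unlift ord0 j is Some i then f i (simplex_to_orthant p) else 0.
have h_continuous j : continuous (h j).
  rewrite /h; case: (unlift ord0 j) => [i p|]; last exact: cst_continuous.
  apply: continuous_comp; first exact: simplex_to_orthant_continuous.
  exact: f_continuous.
have [p ps hmin] := complementary_simplex h_continuous.
pose x := simplex_to_orthant p.
have x_ge0 : nonneg_vec x := simplex_to_orthant_ge0 ps.
have h_slack : h ord0 p = 0 by rewrite /h unlift_none.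
have hE i : h (lift ord0 i) p = f i x by rewrite /h liftK.
have f_le0_or_x_eq0 i : f i x <= 0 \/ x i 0 = 0.
  have [/(_ (lift ord0 i)) + _] := ps.
  rewrite le_eqVlt => /orP[/eqP pi|pi]; first by right; rewrite mxE -pi mulr0.
  by left; rewrite -hE -h_slack hmin.
have slack_gt0 : 0 < p 0 ord0.
  apply: simplex_slack_gt0 => // i.
  have [f_le0|->] := f_le0_or_x_eq0 i; last exact: ltW.
  apply/ltW; rewrite ltNge; apply: contraTN f_le0; rewrite -ltNge.
  exact: f_coercive.
have f_ge0 i : 0 <= f i x by rewrite -hE -h_slack hmin.
exists x; split=> // i.
have [f_le0|->] := f_le0_or_x_eq0 i; last by rewrite mul0r.
suff -> : f i x = 0 by rewrite mulr0.
by apply/eqP; rewrite eq_le f_le0 f_ge0.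
Qed.

End NonlinearComplementarity.

(** * Nonnegative tensors *)

Lemma nonneg_vec_pos_entry (R : realType) (n : nat) (x : 'cV[R]_n) :
  nonneg_vec x -> x != 0 -> exists i, 0 < x i 0.
Proof.
move=> x0; apply: contra_neqP => /forallNP x_le0; apply/colP => i.
by apply/eqP; rewrite mxE eq_le x0 leNgt andbT; apply/negP/x_le0.
Qed.

Section TensorClasses.
Variables (R : realType) (m n : nat).
Implicit Types (A : tensor R m n) (x q : 'cV[R]_n).

Definition tensor_diag A (i : 'I_n) : R := A (nseq_tuple m i).

Lemma R_tensor_R0 A : R_tensor A -> R0_tensor A.
Proof.
move=> RA [x [x0 xn0 xP]]; apply: RA; exists x, 0; split=> // i.
by rewrite addr0.
Qed.

Lemma ER_tensor_R0 A : ER_tensor A -> R0_tensor A.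
Proof.
move=> ERA [x [x0 xn0 xP]]; apply: ERA; exists x, 0; split=> // i.
by rewrite mul0r addr0.
Qed.

Lemma tensor_app_continuous A i : continuous (fun x => tensor_app A x i 0).
Proof.
have -> : (fun x => tensor_app A x i 0) = (fun x : 'cV_n =>
    \sum_(s : m.-tuple 'I_n | ohead s == Some i)
      A s * \prod_(j <- behead s) x j 0).
  by apply: funext => x; rewrite mxE.
apply: continuous_big => [|s _ x]; first exact: add_continuous.
have prod_continuous :
    continuous (fun x : 'cV[R]_n => \prod_(j <- behead s) x j 0).
  apply: continuous_big => [|j _]; first exact: mul_continuous.
  exact: coord_continuous.
exact: cvgM (cvg_cst _) (prod_continuous x).
Qed.

Lemma tensor_app_ge0 A x i :
  nonneg_tensor A -> nonneg_vec x -> 0 <= tensor_app A x i 0.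
Proof.
by move=> A0 x0; rewrite mxE sumr_ge0 // => s _; rewrite mulr_ge0 // prodr_ge0.
Qed.

Lemma TCP_solutionP q A x : TCP_solution q A x <->
  [/\ nonneg_vec x, forall i, 0 <= tensor_app A x i 0 + q i 0 &
      forall i, x i 0 * (tensor_app A x i 0 + q i 0) = 0].
Proof.
have yE i : (tensor_app A x + q) i 0 = tensor_app A x i 0 + q i 0 by rewrite mxE.
have xyE : (x^T *m (tensor_app A x + q)) 0 0 =
    \sum_i x i 0 * (tensor_app A x i 0 + q i 0).
  by rewrite mxE; apply: eq_bigr => i _; rewrite mxE yE.
split=> [[x0 y0 /matrixP/(_ 0 0)]|[x0 y0 xy]].
  have {}y0 i : 0 <= tensor_app A x i 0 + q i 0 by rewrite -yE.
  rewrite xyE mxE => /psumr_eq0P xy; split=> // i.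
  by apply: xy => // j _; rewrite mulr_ge0.
split=> //; first by move=> i; rewrite yE.
by apply/matrixP => a b; rewrite (ord1 a) (ord1 b) xyE mxE big1.
Qed.

End TensorClasses.

Section PositiveDiagonal.
Variables (R : realType) (m n : nat) (A : tensor R m.+1 n).
Implicit Types (x q : 'cV[R]_n) (i j : 'I_n).

Lemma tensor_app_diagD x i : tensor_app A x i 0 = tensor_diag A i * x i 0 ^+ m +
  \sum_(s : m.+1.-tuple 'I_n | (ohead s == Some i) && (s != nseq_tuple m.+1 i))
     A s * \prod_(j <- behead s) x j 0.
Proof.
rewrite mxE (bigD1 (nseq_tuple m.+1 i)) //=.
by rewrite big_nseq iter_mulr_1.
Qed.

Lemma tensor_app_single x i :
  (forall j, j != i -> x j 0 = 0) ->
  tensor_app A x i 0 = tensor_diag A i * x i 0 ^+ m.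
Proof.
move=> x0; rewrite tensor_app_diagD big1 ?addr0 // => s /andP[hs ns].
suff [j js ji] : exists2 j, j \in behead s & j != i.
  by rewrite (big_rem j) //= x0 // mul0r mulr0.
apply/hasP; apply: contraNT ns => /hasPn all_i; apply/eqP/val_inj => /=.
case: s hs all_i => -[|a s] //= /eqP[size_s] /eqP[->] all_i.
congr (_ :: _); rewrite -size_s; apply/all_pred1P/allP => j /all_i.
by rewrite negbK.
Qed.

Hypothesis A_ge0 : nonneg_tensor A.

Lemma tensor_app_ge_diag x i :
  nonneg_vec x -> tensor_diag A i * x i 0 ^+ m <= tensor_app A x i 0.
Proof.
move=> x0; rewrite tensor_app_diagD lerDl sumr_ge0 // => s _.
by rewrite mulr_ge0 // prodr_ge0.
Qed.

Lemma tensor_app_gt0 x i :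
  0 < tensor_diag A i -> nonneg_vec x -> 0 < x i 0 -> 0 < tensor_app A x i 0.
Proof.
move=> dA x0 xi; apply: lt_le_trans (tensor_app_ge_diag i x0).
by rewrite mulr_gt0 // exprn_gt0.
Qed.

Lemma R0_tensor_diag_gt0 : R0_tensor A -> forall i, 0 < tensor_diag A i.
Proof.
move=> R0A i; rewrite lt_neqAle A_ge0 andbT; apply/eqP => d0; apply: R0A.
have e_ge0 : nonneg_vec (delta_mx i 0 : 'cV[R]_n) by move=> j; rewrite mxE ler0n.
exists (delta_mx i 0); split=> //.
  by apply/eqP => /matrixP/(_ i 0)/eqP; rewrite !mxE !eqxx oner_eq0.
move=> j; split=> [|_]; last exact: tensor_app_ge0.
rewrite mxE eqxx andbT; have [->|] := eqVneq j i => [_|]; last by rewrite ltxx.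
rewrite tensor_app_single -?d0 ?mul0r // => l li.
by rewrite mxE (negPf li).
Qed.

(* With q = -1 at i and 1 elsewhere, a solution is supported on {i}. *)
Lemma Q_tensor_diag_gt0 : Q_tensor A -> forall i, 0 < tensor_diag A i.
Proof.
move=> QA i; rewrite lt_neqAle A_ge0 andbT; apply/eqP => d0.
have [x /TCP_solutionP[x0 y0 xy]] := QA (\col_j if j == i then -1 else 1).
have x_off j : j != i -> x j 0 = 0.
  move=> ji; have /eqP := xy j; rewrite [X in _ + X]mxE (negPf ji) mulf_eq0.
  by case/orP=> [/eqP //|]; rewrite gt_eqF // ltr_wpDl // tensor_app_ge0.
have := y0 i; rewrite tensor_app_single // -d0 mul0r add0r mxE eqxx.
by rewrite oppr_ge0 ler10.
Qed.

Hypothesis diag_gt0 : forall i, 0 < tensor_diag A i.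

Lemma diag_gt0_R_tensor : R_tensor A.
Proof.
move=> [x [t [x0 /(nonneg_vec_pos_entry x0)[i xi] t0 /(_ i)[/(_ xi)/eqP]]]].
by rewrite gt_eqF // ltr_pwDl // tensor_app_gt0.
Qed.

Lemma diag_gt0_ER_tensor : ER_tensor A.
Proof.
move=> [x [t [x0 /(nonneg_vec_pos_entry x0)[i xi] t0 /(_ i)[/(_ xi)/eqP]]]].
by rewrite gt_eqF // ltr_pwDl ?tensor_app_gt0 // mulr_ge0.
Qed.

Lemma tensor_app_coercive q : (0 < m)%N -> exists2 rho, 0 < rho &
  forall i x, nonneg_vec x -> rho <= x i 0 -> 0 < tensor_app A x i 0 + q i 0.
Proof.
move=> m0; pose ratio i := `|q i 0| / tensor_diag A i.
have ratio_ge0 i : 0 <= ratio i by rewrite divr_ge0 // ltW.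
have rho1 : 1 <= 1 + \sum_i ratio i by rewrite lerDl sumr_ge0.
exists (1 + \sum_i ratio i) => [|i x x0 xi]; first exact: lt_le_trans rho1.
have xi1 : 1 <= x i 0 := le_trans rho1 xi.
have q_lt : `|q i 0| < tensor_diag A i * x i 0.
  rewrite mulrC -ltr_pdivrMr //; apply: lt_le_trans xi.
  by rewrite (bigD1 i) //= addrCA ltrDl ltr_pwDl // sumr_ge0.
have x_pow : tensor_diag A i * x i 0 <= tensor_diag A i * x i 0 ^+ m.
  by rewrite ler_pM2l // -[leLHS]expr1 ler_weXn2l.
have := tensor_app_ge_diag i x0; have := ler_norm (- q i 0); rewrite normrN; lra.
Qed.

Lemma diag_gt0_Q_tensor : (0 < m)%N -> Q_tensor A.
Proof.
move=> m0 q; have [rho rho_gt0 coercive] := tensor_app_coercive q m0.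
pose f i x := tensor_app A x i 0 + q i 0.
have f_continuous i : continuous (f i).
  by move=> x; apply: cvgD (@tensor_app_continuous _ _ _ A i x) (cvg_cst _).
have [x x_sol] := complementarity_solution f_continuous rho_gt0 coercive.
by exists x; apply/TCP_solutionP.
Qed.

End PositiveDiagonal.

Theorem theorem4p1 (R : realType) (m n : nat) (hm : (3 <= m)%N) (hn : (2 <= n)%N)
    (A : tensor R m n) (hA : nonneg_tensor A) :
  [/\ R0_tensor A <-> R_tensor A,
      R_tensor A <-> Q_tensor A &
      Q_tensor A <-> ER_tensor A].
Proof.
case: m hm A hA => [//|m] hm A hA.
have R0_diag := R0_tensor_diag_gt0 hA.
have R_R0 := @R_tensor_R0 _ _ _ A.
have ER_R0 := @ER_tensor_R0 _ _ _ A.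
have Q_diag := Q_tensor_diag_gt0 hA.
have diag_R := diag_gt0_R_tensor hA.
have diag_ER := diag_gt0_ER_tensor hA.
have diag_Q d := diag_gt0_Q_tensor hA d (ltnW hm).
by split; split; auto.
Qed.
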